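(* Let $\mathbb{K}$ be a commutative $\mathbb{Q}$-algebra, let $n$ be a positive integer and let $a \in \mathbb{K}[x]$. Then $G^n(a)$ is the unique polynomial in $\mathbb{K}[x]$ of degree less than $n$ which is congruent to $a$ modulo $\Phi_n(x)$ and is congruent to $0$ modulo $x^d-1$ for each proper positive divisor $d$ of $n$.
   Context: $\Phi_n(x)$ denotes the $n$-th cyclotomic polynomial; $[x^s]f$ denotes the coefficient of $x^s$ in $f$. For an integer $l$ and positive integer $n$, the Ramanujan sum is $c_n(l)=\sum_{e\mid n,\ e\mid l}\mu(n/e)\,e$ (an integer, regarded as an element of $\mathbb{K}$). For $a\in\mathbb{K}[x]$ and $i\in\mathbb{Z}$, $G^n_i(a)=\sum_{s\ge 0}[x^s]a\cdot c_n(i-s)$, and $G^n(a)=\frac{1}{n}\sum_{0\le i<n}G^n_i(a)x^i$. *)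

(* Defs.v *)
From HB Require Import structures.
From mathcomp Require Import all_boot all_order all_algebra all_field.

Set Implicit Arguments.
Unset Strict Implicit.
Unset Printing Implicit Defensive.

Import Order.TTheory GRing.Theory Num.Theory.
Local Open Scope ring_scope.

(* The value at 0 is a convention. *)
Definition moebius (n : nat) : int :=
  if (0 < n)%N && all (fun p => logn p n == 1%N) (primes n)
  then (-1) ^+ size (primes n) else 0.

Definition ramanujan_sum (n : nat) (l : int) : int :=
  \sum_(e <- divisors n | (e%:Z %| l)%Z) moebius (n %/ e) * e%:Z.

Definition ramanujan_coef (K : comNzRingType) (n : nat) (i : int)
    (a : {poly K}) : K :=
  \sum_(s < size a) a`_s * (ramanujan_sum n (i - s%:Z))%:~R.

(* The factor 1/n is the image in K of the rational number 1/n, as K itself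
   carries no inversion. *)
Definition ramanujan_poly (K : comAlgType rat) (n : nat)
    (a : {poly K}) : {poly K} :=
  ((n%:R^-1 : rat)%:A : K) *:
    \sum_(0 <= i < n) ramanujan_coef n i%:Z a *: 'X^i.

(* K need not be a domain, so polydiv's pseudo-division relation [%|] is not
   available; this is congruence modulo the ideal generated by m. *)
Definition poly_congr (R : comNzRingType) (m p q : {poly R}) : Prop :=
  exists r : {poly R}, p - q = r * m.

Definition cyclotomic_poly (R : comNzRingType) (n : nat) : {poly R} :=
  map_poly intr 'Phi_n.

(* Main.v *)
Require Import Defs.
From HB Require Import structures.
From mathcomp Require Import all_boot all_order all_algebra all_field.
From mathcomp Require Import ring.

Set Implicit Arguments.
Unset Strict Implicit.
Unset Printing Implicit Defensive.

Import Order.TTheory GRing.Theory Num.Theory.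
Local Open Scope ring_scope.

(** Modulo [X^n - 1] one has [G^n(a) = a * g] with [g = G^n(1)], that is
    [n g = \sum_(e | n) mu(n/e) e (X^n - 1)/(X^e - 1)].  For [d | n], the
    quotient [(X^n - 1)/(X^e - 1)] is divisible by [Phi_d] when [d] does not
    divide [e], and is congruent to [n/e] modulo [X^e - 1], hence modulo [Phi_d],
    when it does.  Moebius inversion then gives [g = 1] modulo [Phi_n] and
    [g = 0] modulo [Phi_d] for [d < n].  As [n] is invertible, the identity
    [X (X^n - 1)' - n (X^n - 1) = n] makes complementary factors of [X^n - 1]
    comaximal, so congruences modulo the [Phi_d] combine into congruences modulo
    their products; this yields divisibility by [X^d - 1] and uniqueness. *)

(** * Moebius function and inversion over divisors *)

Lemma moebius_prime_mul (p m : nat) : prime p -> (0 < m)%N -> ~~ (p %| m)%N ->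
  moebius (p * m) = - moebius m.
Proof.
move=> p_pr m_gt0 pNm; have p_gt0 := prime_gt0 p_pr.
have logp : logn p m = 0%N.
  by apply/eqP; rewrite lognE p_pr m_gt0 (negPf pNm).
have pNprimes : p \notin primes m by rewrite mem_primes (negPf pNm) !andbF.
have eq_primes : perm_eq (primes (p * m)) (p :: primes m).
  apply: uniq_perm; rewrite /= ?pNprimes ?primes_uniq // => q.
  by rewrite inE primesM // primes_prime // inE.
rewrite /moebius muln_gt0 p_gt0 m_gt0 /= (perm_all _ eq_primes).
rewrite (perm_size eq_primes) /= lognM // logp addn0 logn_prime // eqxx /=.
have -> : all (fun q => logn q (p * m) == 1%N) (primes m)
        = all (fun q => logn q m == 1%N) (primes m).
  apply: eq_in_all => q qm.
  have qNp : (q == p) = false by apply: contraNF pNprimes => /eqP <-.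
  by rewrite lognM // logn_prime // qNp.
by case: ifP => _; rewrite ?oppr0 // exprS mulN1r.
Qed.

Lemma moebius_square_dvd (p m : nat) : prime p -> (p ^ 2 %| m)%N ->
  moebius m = 0.
Proof.
move=> p_pr p2m; rewrite /moebius; case: ifP => // /andP[m_gt0 /allP logm].
have pm : p \in primes m.
  by rewrite mem_primes p_pr m_gt0 (dvdn_trans _ p2m) // dvdn_exp.
by move: p2m; rewrite pfactor_dvdn // (eqP (logm p pm)).
Qed.

(** Fix a prime [p] dividing [m]. Divisors divisible by [p ^ 2] contribute 0, and [f |-> p * f] maps
    the divisors prime to [p] bijectively onto those divisible by [p] exactly once, changing the
    sign of [moebius]; the two classes cancel. *)
Lemma sum_moebius (m : nat) : (0 < m)%N ->
  \sum_(f <- divisors m) moebius f = (m == 1%N)%:R.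
Proof.
move=> m_gt0; have [-> | m_neq1] := eqVneq m 1%N; first by rewrite big_seq1.
have [p p_pr pm] : exists2 p, prime p & (p %| m)%N.
  by exists (pdiv m); rewrite ?pdiv_dvd // pdiv_prime // ltn_neqAle eq_sym m_neq1.
have p_gt0 := prime_gt0 p_pr.
rewrite (bigID (fun f => p %| f)%N) /=.
rewrite [X in X + _](bigID (fun f => p ^ 2 %| f)%N) /=.
rewrite big1 => [|f /andP[_]]; last exact: moebius_square_dvd.
rewrite add0r; apply/eqP; rewrite addr_eq0 -sumrN; apply/eqP.
transitivity (\sum_(f <- divisors m | ~~ (p %| f)%N) moebius (p * f)); last first.
  rewrite big_seq_cond [RHS]big_seq_cond; apply: eq_bigr => f /andP[fm pNf].
  apply: moebius_prime_mul => //.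
  by move: fm; rewrite -dvdn_divisors //; apply: dvdn_gt0.
rewrite -[LHS]big_filter -[RHS]big_filter -(big_map (muln p) predT moebius).
apply: perm_big; apply: uniq_perm.
- by rewrite filter_uniq ?divisors_uniq.
- rewrite map_inj_uniq ?filter_uniq ?divisors_uniq //.
  by move=> x y /eqP; rewrite eqn_pmul2l // => /eqP.
move=> f; rewrite mem_filter -dvdn_divisors //.
apply/idP/mapP => [/andP[/andP[/dvdnP[g ->] p2]] fm | [g]].
  exists g; last by rewrite mulnC.
  rewrite mem_filter -dvdn_divisors // (dvdn_trans (dvdn_mulr _ _) fm) // andbT.
  by apply: contra p2 => pg; rewrite dvdn_mul.
rewrite mem_filter -dvdn_divisors // => /andP[pNg gm] ->.
rewrite dvdn_mulr //= dvdn_pmul2l // pNg /=.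
by rewrite Gauss_dvd ?pm // prime_coprime.
Qed.

(** The map [e |-> n %/ e] sends the divisors of [n] that are multiples of [d] bijectively onto the
    divisors of [n %/ d]. *)
Lemma sum_moebius_codivisor (n d : nat) : (0 < n)%N -> (d %| n)%N ->
  \sum_(e <- divisors n | (d %| e)%N) moebius (n %/ e) = (d == n)%:R.
Proof.
move=> n_gt0 dn; have d_gt0 := dvdn_gt0 n_gt0 dn.
have q_gt0 : (0 < n %/ d)%N by rewrite divn_gt0 // dvdn_leq.
have -> : (d == n) = (n %/ d == 1)%N by rewrite -eqn_mul // mul1n eq_sym.
rewrite -sum_moebius // -big_filter -(big_map (divn n) predT moebius).
apply: perm_big; apply: uniq_perm; rewrite ?divisors_uniq //.
  rewrite map_inj_in_uniq ?filter_uniq ?divisors_uniq // => x y.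
  rewrite !mem_filter -!dvdn_divisors // => /andP[_ xn] /andP[_ yn] eqxy.
  have /eqP : (n %/ y * x = n %/ y * y)%N by rewrite divnK // -eqxy divnK.
  rewrite eqn_pmul2l => [/eqP // |].
  by rewrite divn_gt0 ?(dvdn_leq n_gt0 yn) // (dvdn_gt0 n_gt0 yn).
move=> f; rewrite -dvdn_divisors //; apply/mapP/idP => [[e] | fq].
  rewrite mem_filter -dvdn_divisors // => /andP[de en] ->.
  have e_gt0 := dvdn_gt0 n_gt0 en.
  rewrite dvdn_divRL // -[X in (_ %| X)%N](divnK en).
  by rewrite dvdn_pmul2l // divn_gt0 // dvdn_leq.
have fdn : (f * d %| n)%N by rewrite -dvdn_divRL.
have fn : (f %| n)%N := dvdn_trans (dvdn_mulr _ (dvdnn _)) fdn.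
exists (n %/ f)%N.
  rewrite mem_filter -dvdn_divisors // dvdn_divRL // mulnC fdn /=.
  by rewrite dvdn_div.
have f_gt0 := dvdn_gt0 n_gt0 fn.
by rewrite -[X in (X %/ _)%N](divnK fn) mulKn // divn_gt0 // dvdn_leq.
Qed.

(** * Polynomial congruences and comaximal factors of ['X^n - 1] *)

Section Congruence.
Variable R : comNzRingType.
Implicit Types m p q r u : {poly R}.

Lemma poly_congr_refl m p : poly_congr m p p.
Proof. by exists 0; rewrite subrr mul0r. Qed.

Lemma poly_congr_sym m p q : poly_congr m p q -> poly_congr m q p.
Proof. by case=> r E; exists (- r); rewrite mulNr -E opprB. Qed.

Lemma poly_congr_trans m p q r :
  poly_congr m p q -> poly_congr m q r -> poly_congr m p r.
Proof.
by case=> u Eu [v Ev]; exists (u + v); rewrite mulrDl -Eu -Ev addrA subrK.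
Qed.

Lemma poly_congrD m p q p' q' :
  poly_congr m p q -> poly_congr m p' q' -> poly_congr m (p + p') (q + q').
Proof. by case=> u Eu [v Ev]; exists (u + v); rewrite mulrDl -Eu -Ev; ring. Qed.

Lemma poly_congrMl u m p q : poly_congr m p q -> poly_congr m (u * p) (u * q).
Proof. by case=> r E; exists (u * r); rewrite -mulrA -E mulrBr. Qed.

Lemma poly_congr_sum (I : eqType) (s : seq I) (F G : I -> {poly R}) m :
  {in s, forall i, poly_congr m (F i) (G i)} ->
  poly_congr m (\sum_(i <- s) F i) (\sum_(i <- s) G i).
Proof.
move=> FG; rewrite big_seq [X in poly_congr _ _ X]big_seq.
apply: (big_rec2 (poly_congr m)) => [|i p q /FG]; first exact: poly_congr_refl.
exact: poly_congrD.
Qed.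

Lemma poly_congr_dvd m u p q : poly_congr (u * m) p q -> poly_congr m p q.
Proof. by case=> r E; exists (r * u); rewrite -mulrA. Qed.

Lemma poly_congr0P m p : poly_congr m p 0 <-> exists r, p = r * m.
Proof. by split=> -[r]; rewrite ?subr0 => E; exists r; rewrite ?subr0. Qed.

(** A nonzero multiple of a monic polynomial has at least its degree, even when [R] has zero
    divisors. *)
Lemma poly_congr_small m p : m \is monic -> (size p < size m)%N ->
  poly_congr m p 0 -> p = 0.
Proof.
move=> m_mon lt_pm /poly_congr0P[r E]; apply: contraTeq lt_pm => p_neq0.
have r_neq0 : r != 0 by apply: contraNneq p_neq0; rewrite E => ->; rewrite mul0r.
rewrite E size_Mmonic // -leqNgt -subn1 -addnBAC ?size_poly_gt0 //.
by rewrite leq_addl.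
Qed.

Lemma poly_congr_mul_Xn_sub_1 (n : nat) (c : R) p q r f :
  c * n%:R = 1 -> p * q * r = 'X^n - 1 ->
  poly_congr p f 0 -> poly_congr q f 0 -> poly_congr (p * q) f 0.
Proof.
move=> cn pqr /poly_congr0P[u fp] /poly_congr0P[v fq].
pose P : {poly R} := 'X^n - 1.
have nE : n%:R = 'X * P^`() - n%:R * P.
  rewrite /P derivB derivXn -polyC1 derivC subr0 polyC1 -mulr_natl.
  case: (n) => [|k] /=; first by rewrite !mul0r mulr0 subrr.
  by rewrite exprS; ring.
have dP : P^`() = p^`() * q * r + p * (q^`() * r + q * r^`()).
  by rewrite /P -pqr !derivM; ring.
apply/poly_congr0P.
(* Expand [n f = (X P' - n P) f] by the product rule. In the term carrying [q], [f] becomes [u * p];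
   in the terms carrying [p], it becomes [v * q]; [P] already contains [p * q]. The witness is the
   resulting cofactor of [p * q], times [c]. *)
exists (c%:P * (u * 'X * p^`() * r + v * 'X * (q^`() * r + q * r^`()) - n%:R * f * r)).
transitivity (c%:P * n%:R * f).
  by rewrite -(polyC_natr R) -polyCM cn mul1r.
rewrite {1}nE dP /P -pqr.
transitivity (c%:P * ('X * p^`() * q * r * f
  + 'X * p * (q^`() * r + q * r^`()) * f - n%:R * (p * q * r) * f)).
  by ring.
rewrite {1}fp {1}fq; ring.
Qed.

Lemma poly_congr_prod_Xn_sub_1 (I : eqType) (s : seq I) (F : I -> {poly R})
    (n : nat) (c : R) r f :
  c * n%:R = 1 -> \prod_(i <- s) F i * r = 'X^n - 1 ->
  {in s, forall i, poly_congr (F i) f 0} ->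
  poly_congr (\prod_(i <- s) F i) f 0.
Proof.
move=> cn; elim: s r => [|i s IHs] r; rewrite ?big_nil ?big_cons => Er fF.
  by exists f; rewrite subr0 mulr1.
apply: (poly_congr_mul_Xn_sub_1 cn Er); first by apply: fF; rewrite mem_head.
(* The factor split off joins the cofactor, so the full product remains ['X^n - 1]. *)
apply: (IHs (F i * r)); first by rewrite mulrCA mulrA.
by move=> j js; apply: fF; rewrite in_cons js orbT.
Qed.

End Congruence.

(** * Cyclotomic factors and quotients of ['X^n - 1] *)

Section XnSub1.
Variable R : comNzRingType.

Lemma prod_cyclotomic_poly (n : nat) : (0 < n)%N ->
  \prod_(d <- divisors n) cyclotomic_poly R d = 'X^n - 1.
Proof.
move=> n_gt0; rewrite -rmorph_prod /= prod_Cyclotomic //.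
by rewrite rmorphB /= map_polyXn rmorph1.
Qed.

Lemma cyclotomic_poly_dvd (d e : nat) : (0 < e)%N -> (d %| e)%N ->
  exists r, 'X^e - 1 = r * cyclotomic_poly R d.
Proof.
move=> e_gt0 de; exists (\prod_(f <- rem d (divisors e)) cyclotomic_poly R f).
have d_e : d \in divisors e by rewrite -dvdn_divisors.
by rewrite -(prod_cyclotomic_poly e_gt0) (big_rem _ d_e) /= mulrC.
Qed.

(** For [e] dividing [n] this is [('X^n - 1) / ('X^e - 1)], written as a geometric sum in ['X^e] to
    avoid any division. *)
Definition Xn_sub_1_quotient (n e : nat) : {poly R} :=
  \sum_(j < n %/ e) 'X^(e * j).

Lemma Xn_sub_1_quotientE (n e : nat) : (e %| n)%N ->
  'X^n - 1 = Xn_sub_1_quotient n e * ('X^e - 1).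
Proof.
move=> en; rewrite -{1}(divnK en) mulnC exprM subrX1 mulrC; congr (_ * _).
by apply: eq_bigr => j _; rewrite exprM.
Qed.

Lemma Xn_sub_1_quotient_congr (n e : nat) :
  poly_congr ('X^e - 1) (Xn_sub_1_quotient n e) (n %/ e)%:R.
Proof.
have -> : (n %/ e)%:R = \sum_(j < n %/ e) 1 :> {poly R}.
  by rewrite sumr_const card_ord.
apply: poly_congr_sum => j _.
by exists (\sum_(i < j) ('X^e) ^+ i); rewrite exprM subrX1 mulrC.
Qed.

Lemma Xn_sub_1_quotient_congr0 (n d e : nat) :
  (0 < n)%N -> (d %| n)%N -> (e %| n)%N -> ~~ (d %| e)%N ->
  poly_congr (cyclotomic_poly R d) (Xn_sub_1_quotient n e) 0.
Proof.
move=> n_gt0 dn en dNe; have e_gt0 := dvdn_gt0 n_gt0 en.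
have quoE : Xn_sub_1_quotient n e
  = \prod_(f <- divisors n | ~~ (f %| e)%N) cyclotomic_poly R f.
  (* Being monic, ['X^e - 1] can be cancelled over any commutative ring; both sides times it give
     ['X^n - 1]. *)
  apply: (monic_rreg (monicXnsubC (1 : R) e_gt0)).
  rewrite -[_ - _]/('X^e - 1%:P) polyC1 -Xn_sub_1_quotientE //.
  rewrite -(prod_cyclotomic_poly n_gt0) (bigID (fun f => f %| e)%N) /= mulrC.
  congr (_ * _); rewrite -prod_cyclotomic_poly // -big_filter.
  apply: perm_big; apply: uniq_perm; rewrite ?filter_uniq ?divisors_uniq //.
  move=> f; rewrite mem_filter -!dvdn_divisors //.
  by apply: andb_idr => fe; apply: dvdn_trans en.
apply/poly_congr0P; rewrite quoE -big_filter (big_rem d) /=; last first.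
  by rewrite mem_filter dNe -dvdn_divisors.
by eexists; rewrite mulrC.
Qed.

Lemma sum_dvd_Xn (n e : nat) : (0 < n)%N -> (e %| n)%N ->
  \sum_(0 <= i < n | (e %| i)%N) 'X^i = Xn_sub_1_quotient n e.
Proof.
move=> n_gt0 en; have e_gt0 := dvdn_gt0 n_gt0 en.
rewrite /Xn_sub_1_quotient -{1}(divnK en).
elim: (n %/ e)%N => [|k IHk]; first by rewrite mul0n big_geq // big_ord0.
rewrite big_ord_recr -IHk (@big_cat_nat _ _ _ (k * e)) //=; last first.
  by rewrite leq_pmul2r.
(* Among the exponents from [k * e] up to, but excluding, [k.+1 * e], only the first is a multiple
   of [e]. *)
congr (_ + _); rewrite big_ltn_cond ?ltn_pmul2r // dvdn_mull // mulnC.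
rewrite big_nat_cond big1 ?addr0 // => i /andP[/andP[lti ilt] /dvdnP[q iE]].
move: lti ilt; rewrite iE [(e * k)%N]mulnC !ltn_pmul2r //.
by rewrite ltnS => kq; rewrite leqNgt kq.
Qed.

(** * Ramanujan sums as coefficients modulo ['X^n - 1] *)

Lemma ramanujan_sum_period (n : nat) (l : int) :
  ramanujan_sum n (n%:Z + l) = ramanujan_sum n l.
Proof.
have [-> | n_gt0] := posnP n; first by rewrite add0r.
rewrite /ramanujan_sum big_seq_cond [RHS]big_seq_cond; apply: eq_bigl => e.
apply: andb_id2l; rewrite -dvdn_divisors // => en.
by rewrite rpredDl.
Qed.

(** This is [n G^n(X^s)]; leaving out [1/n] lets it make sense over any commutative ring. *)
Definition ramanujan_shift (n s : nat) : {poly R} :=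
  \sum_(0 <= i < n) (ramanujan_sum n (i%:Z - s%:Z))%:~R *: 'X^i.

(** Multiplication by ['X] shifts the coefficients. Only the wrap-around from degree [n] to degree 0
    differs, and by periodicity it is a constant times ['X^n - 1]. *)
Lemma ramanujan_shiftS (n s : nat) :
  poly_congr ('X^n - 1) (ramanujan_shift n s.+1) ('X * ramanujan_shift n s).
Proof.
apply: poly_congr_sym.
pose F i : {poly R} := (ramanujan_sum n (i%:Z - s.+1%:Z))%:~R *: 'X^i.
have -> : 'X * ramanujan_shift n s = \sum_(0 <= i < n) F i.+1.
  rewrite big_distrr /=; apply: eq_bigr => i _.
  have -> : i%:Z - s%:Z = i.+1%:Z - s.+1%:Z by rewrite !intS; ring.
  by rewrite -scalerAr -exprS.
have -> : \sum_(0 <= i < n) F i.+1 = ramanujan_shift n s.+1 + (F n - F 0%N).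
  have := telescope_sumr F (leq0n n); rewrite sumrB => <-.
  by rewrite addrC subrK.
exists (ramanujan_sum n (- s.+1%:Z))%:~R%:P.
rewrite addrAC subrr add0r /F ramanujan_sum_period sub0r.
by rewrite mul_polyC scalerBr expr0.
Qed.

Lemma ramanujan_shift_congr (n s : nat) :
  poly_congr ('X^n - 1) (ramanujan_shift n s) ('X^s * ramanujan_shift n 0).
Proof.
elim: s => [|s IHs]; first by rewrite expr0 mul1r; apply: poly_congr_refl.
apply: poly_congr_trans (ramanujan_shiftS n s) _.
by rewrite exprS -mulrA; apply: poly_congrMl.
Qed.

Lemma ramanujan_shift0 (n : nat) : (0 < n)%N ->
  ramanujan_shift n 0 = \sum_(e <- divisors n)
    (moebius (n %/ e) * e%:Z)%:~R *: Xn_sub_1_quotient n e.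
Proof.
move=> n_gt0; rewrite /ramanujan_shift.
transitivity (\sum_(0 <= i < n) \sum_(e <- divisors n)
   if (e %| i)%N then (moebius (n %/ e) * e%:Z)%:~R *: 'X^i else 0 : {poly R}).
  apply: eq_bigr => i _.
  rewrite subr0 /ramanujan_sum rmorph_sum /= scaler_suml -big_mkcond /=.
  by apply: eq_bigl => e.
rewrite exchange_big /= big_seq [RHS]big_seq; apply: eq_bigr => e.
rewrite -dvdn_divisors // => en.
by rewrite -sum_dvd_Xn // scaler_sumr -big_mkcond.
Qed.

Lemma ramanujan_shift0_congr (n d : nat) : (0 < n)%N -> (d %| n)%N ->
  poly_congr (cyclotomic_poly R d) (ramanujan_shift n 0) (n * (d == n))%:R.
Proof.
move=> n_gt0 dn; rewrite ramanujan_shift0 //.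
(* Moebius inversion expands the residue over the divisors of [n], so that the two sums can be
   compared term by term. *)
have -> : (n * (d == n))%:R = \sum_(e <- divisors n)
    (if (d %| e)%N then (n%:Z * moebius (n %/ e))%:~R else 0) :> {poly R}.
  rewrite -big_mkcond /=.
  transitivity ((n%:Z * (d == n)%:R)%:~R : {poly R}).
    by rewrite intrM natrM rmorph_nat -pmulrn.
  by rewrite -(sum_moebius_codivisor n_gt0 dn) mulr_sumr rmorph_sum.
apply: poly_congr_sum => e; rewrite -dvdn_divisors // => en.
have e_gt0 := dvdn_gt0 n_gt0 en.
rewrite -mul_polyC; case: ifP => [de | /negbT dNe]; last first.
  set u := _%:P; rewrite -[X in poly_congr _ _ X](mulr0 u).
  exact/poly_congrMl/Xn_sub_1_quotient_congr0.
(* The weight [e] and the residue [n %/ e] of the quotient multiply to [n], whatever [e] is. *)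
have -> : (n%:Z * moebius (n %/ e))%:~R
        = (moebius (n %/ e) * e%:Z)%:~R%:P * (n %/ e)%:R :> {poly R}.
  rewrite -(polyC_natr R) -polyCM -(rmorph_int (@polyC R)); congr (_%:P).
  by rewrite pmulrn -intrM -mulrA -PoszM mulnC divnK // mulrC.
have [r Er] := cyclotomic_poly_dvd e_gt0 de.
apply/poly_congrMl/(@poly_congr_dvd _ _ r); rewrite -Er.
exact: Xn_sub_1_quotient_congr.
Qed.

End XnSub1.

(** * Residues, degree and uniqueness of [G^n(a)] over a rational algebra *)

Lemma natr_ratalg_unit (K : comAlgType rat) (n : nat) : (0 < n)%N ->
  ((n%:R^-1 : rat)%:A : K) * n%:R = 1.
Proof.
move=> n_gt0; rewrite mulr_algl -scaler_nat scalerA mulVf ?scale1r //.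
by rewrite pnatr_eq0 -lt0n.
Qed.

Lemma ramanujan_poly_size (K : comAlgType rat) (n : nat) (a : {poly K}) :
  (size (ramanujan_poly n a) <= n)%N.
Proof.
apply: leq_trans (size_scale_leq _ _) _.
rewrite big_mkord -(poly_def n (fun i => ramanujan_coef n i%:Z a)).
exact: size_poly.
Qed.

Lemma ramanujan_poly_shiftE (K : comAlgType rat) (n : nat) (a : {poly K}) :
  ramanujan_poly n a = ((n%:R^-1 : rat)%:A : K)%:P *
    \sum_(s < size a) (a`_s)%:P * ramanujan_shift K n s.
Proof.
rewrite /ramanujan_poly -mul_polyC; congr (_ * _).
under eq_bigr do rewrite /ramanujan_coef scaler_suml.
rewrite exchange_big /=; apply: eq_bigr => s _.
by rewrite mul_polyC scaler_sumr; apply: eq_bigr => i _; rewrite scalerA.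
Qed.

(** The multiple [a *+ (d == n)] encodes both residues: [a] for [d = n] and 0 for a proper divisor.
    By linearity, it suffices to treat each monomial ['X^s]. *)
Lemma ramanujan_poly_congr (K : comAlgType rat) (n d : nat) (a : {poly K}) :
  (0 < n)%N -> (d %| n)%N ->
  poly_congr (cyclotomic_poly K d) (ramanujan_poly n a) (a *+ (d == n)).
Proof.
move=> n_gt0 dn; rewrite ramanujan_poly_shiftE.
set c : K := _%:A; have cn : c * n%:R = 1 := natr_ratalg_unit K n_gt0.
have -> : a *+ (d == n)
        = c%:P * \sum_(s < size a) (a`_s)%:P * ('X^s * (n * (d == n))%:R).
  under eq_bigr do rewrite mulrA mul_polyC.
  rewrite -mulr_suml -poly_def coefK natrM mulrCA [c%:P * _]mulrA.
  by rewrite -(polyC_natr K n) -polyCM cn mul1r mulr_natr.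
apply/poly_congrMl/poly_congr_sum => s _; apply/poly_congrMl.
have [r Er] := cyclotomic_poly_dvd K n_gt0 dn.
apply: poly_congr_trans (poly_congrMl _ (ramanujan_shift0_congr K n_gt0 dn)).
by apply: (@poly_congr_dvd _ _ r); rewrite -Er; apply: ramanujan_shift_congr.
Qed.

Theorem theorem3p8 (K : comAlgType rat) (n : nat) (n_gt0 : (0 < n)%N)
    (a : {poly K}) :
  unique
    (fun f : {poly K} =>
       [/\ (size f <= n)%N,
           poly_congr (cyclotomic_poly K n) f a &
           forall d : nat, (0 < d < n)%N -> (d %| n)%N ->
             poly_congr ('X^d - 1) f 0])
    (ramanujan_poly n a).
Proof.
have cn := natr_ratalg_unit K n_gt0.
(* Both existence and uniqueness use this: ['X^d - 1] is the product of its cyclotomic factors, with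
   cofactor [Xn_sub_1_quotient K n d] in ['X^n - 1]. *)
have combine (d : nat) (f : {poly K}) : (d %| n)%N ->
    (forall e, (e %| d)%N -> poly_congr (cyclotomic_poly K e) f 0) ->
    poly_congr ('X^d - 1) f 0.
  move=> dn fe; have d_gt0 := dvdn_gt0 n_gt0 dn.
  rewrite -prod_cyclotomic_poly //.
  apply: (poly_congr_prod_Xn_sub_1 (r := Xn_sub_1_quotient K n d) cn).
    by rewrite prod_cyclotomic_poly // mulrC -Xn_sub_1_quotientE.
  by move=> e; rewrite -dvdn_divisors //; apply: fe.
split=> [|f [size_f f_a f_0]].
  split; first exact: ramanujan_poly_size.
    by have := ramanujan_poly_congr a n_gt0 (dvdnn n); rewrite eqxx.
  move=> d /andP[d_gt0 dltn] dn; apply: combine => // e ed.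
  have := ramanujan_poly_congr a n_gt0 (dvdn_trans ed dn).
  by rewrite ltn_eqF // (leq_ltn_trans (dvdn_leq d_gt0 ed)).
apply/eqP; rewrite -subr_eq0; apply/eqP.
(* The difference has degree less than [n], so it vanishes once it is a multiple of ['X^n - 1]. *)
apply: (@poly_congr_small _ ('X^n - 1)); first exact: monicXnsubC.
  rewrite -polyC1 size_XnsubC // ltnS (leq_trans (size_polyD _ _)) //.
  by rewrite size_polyN geq_max ramanujan_poly_size.
apply: combine => // d dn.
(* The competitor [f] has the same residues as [G^n(a)]: for [d < n], its congruence modulo
   ['X^d - 1] descends to the factor [Phi_d]. *)
have /poly_congr_sym f_d : poly_congr (cyclotomic_poly K d) f (a *+ (d == n)).
  have [-> // | d_neqn] := eqVneq d n.
  have d_gt0 := dvdn_gt0 n_gt0 dn.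
  have [r Er] := cyclotomic_poly_dvd K d_gt0 (dvdnn d).
  apply: (@poly_congr_dvd _ _ r); rewrite -Er; apply: f_0 => //.
  by rewrite d_gt0 ltn_neqAle d_neqn dvdn_leq.
have [r Er] := poly_congr_trans (ramanujan_poly_congr a n_gt0 dn) f_d.
by exists r; rewrite subr0.
Qed.
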